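(* Let $M$ be a matroid with $m$ elements and rank at least $2$, and let $\tau$ be the size of a smallest double transversal of bases of $M$. If $c$ is a colouring of the elements of $M$ using exactly $m-\tau+2$ colours, then $M$ has a heterochromatic basis.
   Context: A double transversal of bases of $M$ is a set $T$ of elements of the ground set such that every basis of $M$ contains at least two elements of $T$. A basis is heterochromatic under a colouring if its elements receive pairwise distinct colours. *)

(* Defs.v *)
From mathcomp Require Import all_boot.

Set Implicit Arguments.
Unset Strict Implicit.
Unset Printing Implicit Defensive.

(* Matroids are given by their independent sets; the ground set is the whole
   of the finite type E. *)
Record matroid (E : finType) := Matroid {
  indep : pred {set E};
  indep0 : indep set0;
  indep_sub : forall I J : {set E}, I \subset J -> indep J -> indep I;
  indep_aug : forall I J : {set E}, indep I -> indep J -> #|I| < #|J| ->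
    exists2 x, x \in J :\: I & indep (x |: I)
}.

Section Matroid.

Variables (E : finType) (M : matroid E).

Definition basis (B : {set E}) : bool := maxset (indep M) B.

(* All bases have the same size, so the maximum is that common size. *)
Definition rank : nat := \max_(B : {set E} | basis B) #|B|.

Definition double_transversal (D : {set E}) : Prop :=
  forall B : {set E}, basis B -> 2 <= #|B :&: D|.

(* Stated as a relation because a matroid of rank less than 2 has no double
   transversal. When the rank is at least 2 the full ground set is one, so
   such a tau exists (and is unique). *)
Definition min_double_transversal_size (tau : nat) : Prop :=
  (exists2 D : {set E}, double_transversal D & #|D| = tau) /\
  (forall D : {set E}, double_transversal D -> tau <= #|D|).

Definition heterochromatic (C : Type) (c : E -> C) (B : {set E}) : Prop :=
  {in B &, injective c}.

End Matroid.

(* Main.v *)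
Require Import Defs.
From mathcomp Require Import all_boot.
From mathcomp Require Import zify.

(** Any set with more than [m - tau] elements misses at most one element of
    some basis.  Let [T] contain one element of each colour, so that
    [#|T| = m - tau + 2], and take a basis [B] with [#|B :\: T| <= 1]; if
    [B :\: T] is a singleton [e], let [t] be the element of [T] with the colour
    of [e].  Since [#|T :\ t| > m - tau] too, [T :\ t] contains an independent
    set of size at least [rank M - 1].  If it is not already a basis, it can be
    augmented from [B], either by an element of [T] or by [e]; the result is a
    basis contained in [T] or in [e |: (T :\ t)], both of which are
    heterochromatic. *)

Set Implicit Arguments.
Unset Strict Implicit.

Section Matroid.

Variables (E : finType) (M : matroid E).

Lemma basis_indep (B : {set E}) : basis M B -> indep M B.
Proof. by case/maxsetP. Qed.

Lemma indep_card_basis (I B : {set E}) :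
  indep M I -> basis M B -> #|I| <= #|B|.
Proof.
move=> indI /maxsetP[indB maxB]; rewrite leqNgt; apply/negP => ltBI.
have [x] := indep_aug indB indI ltBI.
rewrite inE => /andP[xB _] indxB.
by move: xB; rewrite -(maxB _ indxB (subsetU1 x B)) setU11.
Qed.

Lemma indep_basis (I B : {set E}) :
  indep M I -> basis M B -> #|B| <= #|I| -> basis M I.
Proof.
move=> indI basB leBI; apply/maxsetP; split=> // J indJ sIJ.
apply/esym/eqP; rewrite eqEcard sIJ /=.
exact: leq_trans (indep_card_basis indJ basB) leBI.
Qed.

(** Otherwise every basis would have two elements outside [S], making [~: S] a double transversal
    with fewer than [tau] elements. *)
Lemma basis_almost_sub (tau : nat) (S : {set E}) :
  min_double_transversal_size M tau -> #|E| - tau < #|S| ->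
  exists2 B : {set E}, basis M B & #|B :\: S| <= 1.
Proof.
case=> _ min_tau ltS.
have [/exists_inP[B basB leB]|] := boolP [exists (B | basis M B), #|B :\: S| <= 1].
  by exists B.
rewrite negb_exists_in => /forall_inP noB.
suff /min_tau : double_transversal M (~: S) by have := cardsC S; lia.
by move=> B /noB; rewrite -ltnNge setDE.
Qed.

Lemma heterochromatic_sub (C : Type) (c : E -> C) (A B : {set E}) :
  A \subset B -> heterochromatic c B -> heterochromatic c A.
Proof. by move=> /subsetP sAB injB x y /sAB xB /sAB yB; apply: injB. Qed.

(** Only [t] has its colour in [T], so removing it frees that colour for [e]. *)
Lemma heterochromatic_swap (C : Type) (c : E -> C) (T : {set E}) (t e : E) :
  heterochromatic c T -> t \in T -> c t = c e ->
  heterochromatic c (e |: (T :\ t)).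
Proof.
move=> injT tT cte.
have ne_e x : x \in T :\ t -> c x <> c e.
  by rewrite !inE -cte => /andP[/eqP xt xT] /(injT _ _ xT tT).
move=> x y /setU1P[->|xT] /setU1P[->|yT] //.
- by move=> /esym /(ne_e _ yT).
- by move=> /(ne_e _ xT).
- by apply: injT; [case/setD1P: xT | case/setD1P: yT].
Qed.

Lemma colour_transversal (C : finType) (c : E -> C) :
  exists2 T : {set E}, heterochromatic c T & c @: T = [set c x | x : E].
Proof.
pose rep x := odflt x [pick y | c y == c x].
have c_rep x : c (rep x) = c x by rewrite /rep; case: pickP => //= y /eqP.
have eq_rep x y : c x = c y -> rep x = rep y.
  rewrite /rep => cxy; rewrite cxy.
  (* Both picks now use the same predicate; only the defaults differ, and they are never reached
     since [y] satisfies it. *)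
  by case: pickP => //= /(_ y); rewrite eqxx.
exists (rep @: E).
  move=> _ _ /imsetP[x _ ->] /imsetP[y _ ->].
  by rewrite !c_rep; apply: eq_rep.
by rewrite -imset_comp; apply: eq_imset => x /=.
Qed.

End Matroid.

Theorem theorem6 (E : finType) (M : matroid E) (m tau : nat)
    (hm : #|E| = m) (hrank : 2 <= rank M)
    (htau : min_double_transversal_size M tau)
    (C : finType) (c : E -> C)
    (hc : #|[set c x | x : E]| = m - tau + 2) :
  exists B : {set E}, basis M B /\ heterochromatic c B.
Proof.
have [T injT cT] := @colour_transversal E C c.
have cardT : #|T| = #|E| - tau + 2 by rewrite hm -hc -cT card_in_imset.
have [|B basB] := @basis_almost_sub E M tau T htau; first by lia.
rewrite leq_eqVlt ltnS leqn0 cards_eq0 setD_eq0 => /orP[/cards1P[e BT]|sBT]; last first.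
  by exists B; split=> //; apply: heterochromatic_sub injT.
have [t tT cte] : exists2 t, t \in T & c t = c e.
  have : c e \in c @: T by rewrite cT imset_f.
  by case/imsetP=> t tT ->; exists t.
(* The [+ 2] in the number of colours leaves room to drop [t] and stay above the bound. *)
have [|B' basB' leB'] := @basis_almost_sub E M tau (T :\ t) htau.
  by move: cardT; rewrite (cardsD1 t T) tT; lia.
have [sB'T|nsB'T] := boolP (B' \subset T).
  by exists B'; split=> //; apply: heterochromatic_sub injT.
pose J := B' :&: (T :\ t).
have indJ : indep M J by apply: indep_sub (basis_indep basB'); apply: subsetIl.
have cardB' := cardsID (T :\ t) B'.
have leB'B := indep_card_basis (basis_indep basB') basB.
have leBB' := indep_card_basis (basis_indep basB) basB'.
(* As [B'] is not inside [T], it loses exactly one element in [J], so one augmentation gives a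
   basis. *)
have ltJB : #|J| < #|B|.
  suff : 0 < #|B' :\: (T :\ t)| by rewrite /J; lia.
  rewrite card_gt0 setD_eq0; apply: contra nsB'T => /subset_trans; apply.
  exact: subsetDl.
have [x /setDP[xB xJ] indxJ] := indep_aug indJ (basis_indep basB) ltJB.
have basxJ : basis M (x |: J).
  by apply: indep_basis indxJ basB _; rewrite cardsU1 xJ /J; lia.
exists (x |: J); split=> //.
have sJ : J \subset T :\ t by apply: subsetIr.
(* In the first case [x] may be [t] itself, which is harmless: [x |: J] lies in [T]. *)
have [xT|xT] := boolP (x \in T).
  apply: heterochromatic_sub injT.
  by rewrite subUset sub1set xT (subset_trans sJ) ?subsetDl.
have /set1P-> : x \in [set e] by rewrite -BT inE xT.
by apply: heterochromatic_sub (heterochromatic_swap _ tT cte); rewrite ?setUS.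
Qed.
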